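(* Let $[a,b]\subset\mathbb{R}$ be a compact interval, let $n\ge1$, let $\mathfrak{D}=\sum_{j=0}^{n}p_j(x)\partial^j$ be a linear differential operator of order $n$ with real polynomial coefficients, and let $p\ge0$ be an integer. Let $f\in\mathcal{PD}(\mathfrak{D},p)$, $f\not\equiv0$, with discontinuity points $$a=\xi_0<\xi_1<\dots<\xi_p<\xi_{p+1}=b.$$ Assume that $p_n(\xi_j)\ne0$ for at least one $j\in\{0,\dots,p+1\}$. Then at most $$(p+2)n+\alpha(\mathfrak{D})-1$$ first moments of $f$ can vanish; that is, the equalities $m_0(f)=m_1(f)=\dots=m_{(p+2)n+\alpha(\mathfrak{D})-1}(f)=0$ cannot all hold.
   Context: $\partial=d/dx$, and $p_n\not\equiv0$. Let $d_j=\deg p_j$ ($-\infty$ if $p_j\equiv0$), $\alpha_j=d_j-j$, and $\alpha(\mathfrak{D})=\max_{0\le j\le n}\alpha_j$. Class $\mathcal{PD}(\mathfrak{D},p)$: bounded piecewise-continuous functions $f:[a,b]\to\mathbb{R}$ with points of discontinuity of the first kind (jumps) $a=\xi_0<\xi_1<\dots<\xi_p<\xi_{p+1}=b$, such that on each continuity interval $[\xi_j,\xi_{j+1}]$ $f$ (with one-sided limits as endpoint values) is $n$ times continuously differentiable and satisfies $\mathfrak{D}f=0$. With the convention $f(a^-)=f(b^+)=0$ (i.e. $f$ is extended by zero outside $[a,b]$), the endpoints are also counted as points of discontinuity, so that $f(\xi_j^+)\neq f(\xi_j^-)$ for every $j=0,\dots,p+1$. Values of $f$ at the $\xi_j$ are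 immaterial: $f\equiv0$ means $f$ vanishes off the $\xi_j$. Moments: $m_k(f)=\int_a^b x^kf(x)\,dx$, $k=0,1,2,\dots$. *)

(* Defs.v *)
From HB Require Import structures.
From mathcomp Require Import all_boot all_order all_algebra.
From mathcomp Require Import all_classical all_reals all_analysis.

Set Implicit Arguments.
Unset Strict Implicit.
Unset Printing Implicit Defensive.

Import Order.TTheory GRing.Theory Num.Theory.
Import numFieldNormedType.Exports.

Local Open Scope classical_set_scope.
Local Open Scope ring_scope.

(* Library: MathComp and MathComp-Analysis. *)

(* A differential operator D = \sum_(j <= n) p_j(x) d^j/dx^j is represented by
   its coefficients D : 'I_n.+1 -> {poly R}, with D j = p_j. *)

(* The degree takes the value -oo at the zero polynomial, hence \bar int. *)
Definition deg (R : realType) (q : {poly R}) : \bar int :=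
  if q == 0 then -oo%E else ((size q).-1%:Z)%:E.

Definition alpha (R : realType) (n : nat) (D : 'I_n.+1 -> {poly R}) : \bar int :=
  (\big[maxe/-oo]_(j < n.+1) (deg (D j) - (j%:Z)%:E))%E.

(* Differentiation relative to a set A: the increment is restricted to A, so
   that on a closed interval the derivative is one-sided at the endpoints. *)
Definition derivable_on (R : realType) (A : set R) (g : R -> R) : Prop :=
  forall x, A x -> cvg ((g y - g x) / (y - x) @[y --> within A x^']).

Definition derive_on (R : realType) (A : set R) (g : R -> R) (x : R) : R :=
  lim ((g y - g x) / (y - x) @[y --> within A x^']).

Definition derive_on_n (R : realType) (A : set R) (i : nat) (g : R -> R) :
  R -> R := iter i (derive_on A) g.

Definition Cn_on (R : realType) (A : set R) (n : nat) (g : R -> R) : Prop :=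
  (forall i, (i < n)%N -> derivable_on A (derive_on_n A i g)) /\
  {within A, continuous (derive_on_n A n g)}.

Definition apply_diffop_on (R : realType) (A : set R) (n : nat)
    (D : 'I_n.+1 -> {poly R}) (g : R -> R) (x : R) : R :=
  \sum_(j < n.+1) (D j).[x] * derive_on_n A j g x.

(* f on [c, d], its values at c and d being replaced by its inner one-sided
   limits there. *)
Definition closed_branch (R : realType) (f : R -> R) (c d x : R) : R :=
  if x == c then lim (f y @[y --> c^'+])
  else if x == d then lim (f y @[y --> d^'-])
  else f x.

Definition jump_at (R : realType) (g : R -> R) (x : R) : Prop :=
  [/\ cvg (g y @[y --> x^'-]), cvg (g y @[y --> x^'+]) &
      lim (g y @[y --> x^'+]) != lim (g y @[y --> x^'-])].

(* Only the values of f on [a, b] matter.  The jumps are those of the extension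
   of f by zero outside [a, b], so that a and b are jump points too. *)
Record PD (R : realType) (n p : nat) (D : 'I_n.+1 -> {poly R}) (a b : R)
    (xi : 'I_p.+2 -> R) (f : R -> R) : Prop := {
  PD_first : xi ord0 = a;
  PD_last : xi ord_max = b;
  PD_increasing : forall i j : 'I_p.+2, (i < j)%N -> xi i < xi j;
  PD_bounded : [bounded f x | x in `[a, b]];
  PD_jump : forall j : 'I_p.+2, jump_at (f \_ `[a, b]) (xi j);
  PD_smooth : forall i j : 'I_p.+2, j = i.+1 :> nat ->
    Cn_on `[xi i, xi j] n (closed_branch f (xi i) (xi j));
  PD_equation : forall i j : 'I_p.+2, j = i.+1 :> nat ->
    forall x, x \in `[xi i, xi j] ->
    apply_diffop_on `[xi i, xi j] D (closed_branch f (xi i) (xi j)) x = 0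
}.

Definition vanishes_off (R : realType) (p : nat) (a b : R)
    (xi : 'I_p.+2 -> R) (f : R -> R) : Prop :=
  forall x, x \in `[a, b] -> (forall j, x != xi j) -> f x = 0.

Definition moment (R : realType) (a b : R) (f : R -> R) (k : nat) : R :=
  \int[lebesgue_measure]_(x in `[a, b]) (x ^+ k * f x).

(* Main.v *)
Require Import Defs.
From HB Require Import structures.
From mathcomp Require Import all_boot all_order all_algebra.
From mathcomp Require Import all_classical all_reals all_analysis.
From mathcomp Require Import measurable_realfun ring zify.

Set Implicit Arguments.
Unset Strict Implicit.
Unset Printing Implicit Defensive.

Import Order.TTheory GRing.Theory Num.Theory.
Import numFieldNormedType.Exports.

Local Open Scope classical_set_scope.
Local Open Scope ring_scope.

(* If D* is the formal adjoint of D, then on each continuity interval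
   f (D* q) = q (D f) - (B q)' = - (B q)' for a bilinear concomitant B, so that
   the integral of f (D* q) is a sum of boundary terms at the points xi_i. Fix j
   with p_n(xi_j) <> 0 and let q be the product of (x - xi_j)^(n-1) and of all
   (x - xi_i)^n, i <> j.  The boundary terms at xi_i, i <> j, vanish, and at xi_j
   only the one with q^(n-1) p_n survives: it is a nonzero multiple of the jump
   of f.  Since q has degree (p+2)n - 1, D* q has degree at most
   (p+2)n - 1 + alpha(D), hence the integral of f (D* q) would be zero if the
   moments up to that order vanished. *)

(** * Derivatives relative to a set *)

Lemma cvg_shift_dnbhs (R : realType) (x : R) : h + x @[h --> 0^'] --> x^'.
Proof.
move=> U; rewrite /= /dnbhs /within /= => xU.
have := near_shift 0 x [set y | y != x -> U y]; rewrite subr0 /prop_near1 => E.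
have : nbhs x [set y | y != x -> U y] by exact: xU.
rewrite E; apply: filterS => h /= + h0; apply.
by rewrite -subr_eq0 addrK.
Qed.

Section DerivableOn.
Variables (R : realType) (A : set R) (g : R -> R).

Lemma derivable_on_cvg x : derivable_on A g -> A x ->
  g y @[y --> within A (nbhs x)] --> g x.
Proof.
move=> dg Ax; have /cvg_ex[L gL] := dg x Ax.
have gx : g y @[y --> within A x^'] --> g x.
  (* At y = x both sides are g x, because the quotient is then 0 / 0 = 0. *)
  have -> : g = fun y => (g y - g x) / (y - x) * (y - x) + g x.
    apply/funext => y; have [->|yx] := eqVneq y x.
      by rewrite !subrr mulr0 add0r.
    by rewrite divfK ?subrK // subr_eq0.
  rewrite [X in _ --> X](_ : _ = L * (x - x) + g x); last first.
    by rewrite !subrr !mulr0.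
  have xx : y @[y --> within A x^'] --> x.
    by move=> U xU; apply: cvg_within; exact: nbhs_dnbhs.
  apply: cvgD; last exact: cvg_cst.
  apply: cvgM => //; apply: cvgB => //; exact: cvg_cst.
(* The punctured limit extends to [x] itself, because any neighbourhood of [g x] contains [g x]. *)
move=> U xU.
have xU1 : nbhs x [set y | y != x -> A y -> U (g y)] by exact: gx.
suff : nbhs x [set y | A y -> U (g y)] by [].
move: xU1; apply: filterS => y /= yU; have [->|yx] := eqVneq y x; last exact: yU.
by move=> _; exact: nbhs_singleton.
Qed.

(** At an interior point [A] belongs to the punctured filter, so restricting increments to [A]
    changes nothing. *)
Lemma is_derive_on x : derivable_on A g -> A^° x ->
  is_derive x (1 : R) g (derive_on A g x).
Proof.
move=> dg Ax.
have AxE : within A x^' = x^'.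
  apply/seteqP; split=> [U|U xU]; last first.
    by apply: (@filterS _ x^' _ U) => // y Uy _.
  rewrite /within /= => AU; have : x^' A by apply: nbhs_dnbhs.
  by apply: filterS2 AU => y; apply.
have dgx := dg x (interior_subset Ax).
have gE : (fun h => h^-1 *: ((g \o shift x) (h *: 1) - g x)) =
    (fun y => (g y - g x) / (y - x)) \o (fun h => h + x).
  apply/funext => h /=; rewrite addrK mulrC.
  by rewrite /GRing.scale /= mulr1.
have dL : h^-1 *: ((g \o shift x) (h *: 1) - g x) @[h --> 0^'] -->
    derive_on A g x.
  rewrite gE; apply: cvg_comp; first exact: cvg_shift_dnbhs.
  by move: dgx; rewrite /derive_on AxE.
split; first by apply/cvg_ex; exists (derive_on A g x).
exact: cvg_lim dL.
Qed.

End DerivableOn.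

(* For G i = g^(i), this is the sum over i < k of (-1)^i g^(k-1-i) P^(i), a
   primitive of g^(k) P - (-1)^k g P^(k). *)
Fixpoint concomitant (R : realType) (G : nat -> R -> R) (k : nat)
    (P : {poly R}) (x : R) : R :=
  if k is k'.+1 then G k' x * P.[x] - concomitant G k' P^`() x else 0.

(** * Repeated integration by parts for a single term of the operator *)

Section Concomitant.
Variables (R : realType) (G : nat -> R -> R).

(** The sum telescopes: the term [G k * P'] in the derivative of [G k * P] cancels against the
    leading term given by the induction hypothesis for [P']. *)
Lemma is_derive_concomitant k (P : {poly R}) (x : R) :
  (forall i, (i < k)%N -> is_derive x (1 : R) (G i) (G i.+1 x)) ->
  is_derive x (1 : R) (concomitant G k P)
    (G k x * P.[x] - (-1) ^+ k * (G 0 x * (P^`(k)).[x])).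
Proof.
elim: k P => [|k IH] P dG /=.
  by rewrite expr0 mul1r subrr; exact: is_derive_cst.
have dGk := dG k (ltnSn k).
have IHk := IH P^`() (fun i ik => dG i (ltnW ik)).
have dP := is_derive_poly P x.
apply: is_derive_eq.
rewrite -derivSn exprS /GRing.scale/=; ring.
Qed.

Lemma cvg_concomitant (F : set_system R) k (P : {poly R}) x :
  Filter F -> F `=>` nbhs x ->
  (forall i, (i < k)%N -> G i y @[y --> F] --> G i x) ->
  concomitant G k P y @[y --> F] --> concomitant G k P x.
Proof.
move=> FF Fx; elim: k P => [|k IH] P cG /=; first exact: cvg_cst.
apply: cvgB; last by apply: IH => i ik; apply: cG; exact: ltnW.
apply: cvgM; first exact: cG.
by apply: cvg_trans (@continuous_horner R P x); apply: cvg_app.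
Qed.

Lemma concomitant_eq0 k (P : {poly R}) (x : R) :
  (forall i, (i < k)%N -> (P^`(i)).[x] = 0) -> concomitant G k P x = 0.
Proof.
elim: k P => //= k IH P P0.
rewrite IH ?subr0 => [|i ik]; last by rewrite -derivSn P0.
by rewrite -[P]derivn0 P0 ?mulr0.
Qed.

(** Only the last summand contains the derivative of [P] of order [k], and its other factor is
    [G 0]: no higher derivative of the solution survives. *)
Lemma concomitantS k (P : {poly R}) (x : R) :
  (forall i, (i < k)%N -> (P^`(i)).[x] = 0) ->
  concomitant G k.+1 P x = (-1) ^+ k * (G 0 x * (P^`(k)).[x]).
Proof.
elim: k P => [|k IH] P P0 /=.
  by rewrite subr0 expr0 mul1r.
have := IH P^`(); rewrite /= => -> => [|i ik]; last by rewrite -derivSn P0.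
by rewrite -{1}[P]derivn0 P0 // -derivSn exprS; ring.
Qed.

End Concomitant.

Lemma derivn_mul_XsubC_exp (R : realType) (s : {poly R}) (c : R) m i :
  (i <= m)%N ->
  ((s * ('X - c%:P) ^+ m)^`(i)).[c] = (s.[c] *+ m`!) *+ (i == m).
Proof.
elim: m i s => [|m IH] [|i] s //.
- by rewrite expr0 mulr1 fact0.
- by rewrite derivn0 hornerM horner_exp hornerXsubC subrr expr0n mulr0 mulr0n.
rewrite ltnS => im; rewrite derivSn.
(* The derivative keeps the same shape; its new cofactor equals [m.+1] times [s.[c]] at [c], which
   builds up the factorial. *)
have -> : (s * ('X - c%:P) ^+ m.+1)^`() =
    (s^`() * ('X - c%:P) + s *+ m.+1) * ('X - c%:P) ^+ m.
  rewrite derivM deriv_exp derivXsubC mul1r /= exprS; ring.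
rewrite IH // eqSS !hornerE subrr mulr0 add0r hornerMn factS.
by rewrite mulrnA.
Qed.

(** * The formal adjoint and Lagrange's identity *)

Section Adjoint.
Variables (R : realType) (n : nat) (D : 'I_n.+1 -> {poly R}).

Definition adjoint (q : {poly R}) : {poly R} :=
  \sum_(k < n.+1) (-1) ^+ k *: (D k * q)^`(k).

(** Multiplying by [D k] and differentiating [k] times raises the degree by at most [deg (D k) - k],
    hence by at most [alpha D]; the final [1] turns [size q] into a degree. *)
Lemma adjoint_coef_eq0 (q : {poly R}) i :
  ~ ((i%:Z)%:E <= ((size q)%:Z)%:E + alpha D - (1%:Z)%:E)%E ->
  (adjoint q)`_i = 0.
Proof.
move=> iN; rewrite coef_sum big1 // => k _.
rewrite coefZ coef_derivn nth_default ?mul0rn ?mulr0 // leqNgt.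
apply/negP => ki; apply: iN.
have Dk0 : D k != 0 by apply: contraTneq ki => ->; rewrite mul0r size_poly0.
have {}ki := leq_trans ki (size_polyMleq (D k) q).
have sD : (0 < size (D k))%N by rewrite size_poly_gt0.
(* Since [D k] is nonzero, this bound excludes [alpha D = -oo]. *)
have : (deg (D k) - (k%:Z)%:E <= alpha D)%E.
  exact: (le_bigmax_cond _ (fun j : 'I_n.+1 => deg (D j) - (j%:Z)%:E)%E).
rewrite /deg (negbTE Dk0); case: (alpha D) => [r||] //= rk.
rewrite -!EFinD !lee_fin /= in rk *.
have arith (d s : nat) : (k + i < (d + s).-1)%N -> (0 < d)%N ->
    d.-1%:Z - (k : nat)%:Z <= r -> i%:Z <= s%:Z + r - 1%:Z by lia.
exact: arith ki sD rk.
Qed.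

Variables (A : set R) (g : R -> R).

Definition boundary_form (q : {poly R}) (x : R) : R :=
  \sum_(k < n.+1) concomitant (fun i => derive_on_n A i g) k (D k * q) x.

(** The concomitants of index [k <= n] involve derivatives of order below [n] only, and a zero of
    order [n] kills all of these. *)
Lemma boundary_form_eq0 (s : {poly R}) (x : R) :
  boundary_form (s * ('X - x%:P) ^+ n) x = 0.
Proof.
rewrite /boundary_form big1 // => k _; apply: concomitant_eq0 => i ik.
have in_ : (i < n)%N by apply: leq_trans ik _; rewrite -ltnS.
by rewrite mulrA derivn_mul_XsubC_exp ?(ltnW in_) // (ltn_eqF in_) mulr0n.
Qed.

(** With a zero of order [n - 1], a derivative of order [n - 1] is needed for a nonzero term, and
    only the concomitant of index [n] reaches it. *)
Lemma boundary_formE m (s : {poly R}) (x : R) : n = m.+1 ->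
  boundary_form (s * ('X - x%:P) ^+ m) x =
  (-1) ^+ m * (g x * ((D ord_max * s).[x] *+ m`!)).
Proof.
move=> nm; rewrite /boundary_form big_ord_recr /= big1 ?add0r => [|k _].
  rewrite {1}nm mulrA concomitantS => [|i im].
    by rewrite derivn_mul_XsubC_exp // eqxx.
  by rewrite derivn_mul_XsubC_exp ?(ltnW im) // (ltn_eqF im).
apply: concomitant_eq0 => i ik.
have im : (i < m)%N by apply: leq_trans ik _; rewrite -ltnS -nm.
by rewrite mulrA derivn_mul_XsubC_exp ?(ltnW im) // (ltn_eqF im) mulr0n.
Qed.

(** Lagrange's identity: the derivative of the boundary form is [q] times [D g], which is zero here,
    minus [g] times the adjoint of [q]. *)
Lemma is_derive_boundary_form (q : {poly R}) (x : R) :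
  Cn_on A n g -> A^° x -> apply_diffop_on A D g x = 0 ->
  is_derive x (1 : R) (boundary_form q) (- (g x * (adjoint q).[x])).
Proof.
move=> [dg _] Ax Dg0.
have dk (k : 'I_n.+1) := @is_derive_concomitant R
  (fun i => derive_on_n A i g) k (D k * q) x
  (fun i ik => is_derive_on (dg i (leq_trans ik (leq_ord k))) Ax).
have := is_derive_sum dk.
rewrite [X in is_derive x 1 X _](_ : _ = boundary_form q); last first.
  by apply/funext => y; rewrite /boundary_form fct_sumE.
move=> dB; apply: (@is_derive_eq _ _ _ _ _ _ _ _ dB).
rewrite sumrB /adjoint horner_sum mulr_sumr.
have -> : \sum_(k < n.+1) derive_on_n A k g x * (D k * q).[x] = 0.
  rewrite (eq_bigr (fun k => (D k).[x] * derive_on_n A k g x * q.[x])).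
    by rewrite -mulr_suml [X in X * _]Dg0 mul0r.
  by move=> k _; rewrite hornerM; ring.
rewrite sub0r; congr (- _); apply: eq_bigr => k _.
by rewrite hornerZ mulrCA.
Qed.

End Adjoint.

(** * Integration over one continuity interval *)

Section Piece.
Variables (R : realType) (c d : R).
Hypothesis cd : c < d.
Local Notation mu := lebesgue_measure.

Lemma integrable_itvcc_oo (h : R -> \bar R) :
  mu.-integrable `]c, d[ h -> mu.-integrable `[c, d] h.
Proof.
move=> /integrableP[mh ih]; have mh' := emeasurable_fun_itv_cc mh.
apply/integrableP; split=> //; rewrite integral_itv_bndoo //.
by apply: measurableT_comp.
Qed.

(** Used to pass between [f] and its closed branch, which may differ at the two endpoints, a null
    set. *)
Lemma eq_integrable_itvoo (h k : R -> R) : {in `]c, d[, h =1 k} ->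
  mu.-integrable `[c, d] (EFin \o k) -> mu.-integrable `[c, d] (EFin \o h).
Proof.
move=> hk ik; apply: integrable_itvcc_oo.
have : mu.-integrable `]c, d[ (EFin \o k).
  by apply: integrableS ik => //; exact: subset_itv_oo_cc.
apply: eq_integrable => // x; rewrite inE /= => xcd.
by rewrite hk.
Qed.

Lemma eq_Rintegral_itvoo (h k : R -> R) : {in `]c, d[, h =1 k} ->
  mu.-integrable `[c, d] (EFin \o k) ->
  \int[mu]_(x in `[c, d]) h x = \int[mu]_(x in `[c, d]) k x.
Proof.
move=> hk ik; rewrite /Rintegral; congr fine.
apply: eq_integral_itv_bounded => //.
  have /integrableP[/measurable_EFinP + _] := eq_integrable_itvoo hk ik.
  by apply: measurable_funS => //; exact: subset_itv_oo_cc.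
have /integrableP[/measurable_EFinP + _] := ik.
by apply: measurable_funS => //; exact: subset_itv_oo_cc.
Qed.

Lemma integrable_cat (a : R) (h : R -> \bar R) : a <= c ->
  mu.-integrable `[a, c] h -> mu.-integrable `[c, d] h ->
  mu.-integrable `[a, d] h.
Proof.
move=> ac /integrableP[m1 i1] /integrableP[m2 i2].
(* The common point [c] is removed from the second interval to make the union disjoint. *)
have E : `[a, d]%classic = `[a, c] `|` `]c, d] :> set R.
  by rewrite -itv_bndbnd_setU // bnd_simp // ltW.
have m2' := (emeasurable_fun_itv_obnd_cbndP _ _ _).2 m2.
rewrite E; apply/integrableP; split.
  exact/measurable_funU.
rewrite ge0_integral_setU //; last 2 first.
- apply: measurableT_comp => //; exact/measurable_funU.
- apply/disj_setPS => x [] /=; rewrite !in_itv /= => /andP[_ xc] /andP[cx _].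
  by move: (le_lt_trans xc cx); rewrite ltxx.
apply: lte_add_pinfty => //.
rewrite integral_itv_obnd_cbnd //.
by apply: measurableT_comp.
Qed.

Lemma Rintegral_cat (a : R) (h : R -> R) : a <= c ->
  mu.-integrable `[a, c] (EFin \o h) -> mu.-integrable `[c, d] (EFin \o h) ->
  \int[mu]_(x in `[a, d]) h x =
  \int[mu]_(x in `[a, c]) h x + \int[mu]_(x in `[c, d]) h x.
Proof.
move=> ac i1 i2; have i3 := integrable_cat ac i1 i2.
have i4 : mu.-integrable `]c, d] (EFin \o h).
  by apply: integrableS i2 => //; exact: subset_itv_oc_cc.
rewrite -(Rintegral_itv_obnd_cbnd i4) -(Rintegral_itvB i3) ?bnd_simp //.
  by rewrite addrC subrK.
exact: ltW.
Qed.

Variables (n : nat) (D : 'I_n.+1 -> {poly R}) (g : R -> R).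

Lemma Cn_on_cvg (A : set R) i x : Cn_on A n g -> (i <= n)%N -> A x ->
  derive_on_n A i g y @[y --> within A (nbhs x)] --> derive_on_n A i g x.
Proof.
move=> [dg cg]; rewrite leq_eqVlt => /predU1P[->|im] Ax.
  by move/subspace_continuousP : cg; apply.
exact: derivable_on_cvg (dg i im) Ax.
Qed.

Lemma Cn_on_mul_horner_within (A : set R) (r : {poly R}) :
  Cn_on A n g -> {within A, continuous (fun x => g x * r.[x])}.
Proof.
move=> Cg; apply/subspace_continuousP => x Ax; apply: cvgM.
  exact: (Cn_on_cvg Cg (leq0n n) Ax).
apply: cvg_trans (@continuous_horner R r x).
by apply: cvg_app; exact: cvg_within.
Qed.

Lemma integrable_Cn_on_mul_horner (r : {poly R}) : Cn_on `[c, d] n g ->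
  mu.-integrable `[c, d] (EFin \o (fun x => g x * r.[x])).
Proof.
move=> Cg; apply: continuous_compact_integrable; first exact: segment_compact.
exact: Cn_on_mul_horner_within.
Qed.

(** Fundamental theorem of calculus for [- B], a primitive of the integrand inside the interval. *)
Lemma integral_adjoint (q : {poly R}) : Cn_on `[c, d] n g ->
  (forall x, x \in `[c, d] -> apply_diffop_on `[c, d] D g x = 0) ->
  \int[mu]_(x in `[c, d]) (g x * (adjoint D q).[x]) =
  boundary_form D `[c, d] g q c - boundary_form D `[c, d] g q d.
Proof.
set B := boundary_form D `[c, d] g q => Cg Dg.
(* Continuity up to the endpoints holds because [B] involves only derivatives of order below [n]. *)
have cB : {within `[c, d], continuous B}.
  apply/subspace_continuousP => x Ax; apply: cvg_big => [|k _].
    exact: add_continuous.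
  apply: cvg_concomitant => [|i ik]; first exact: cvg_within.
  apply: Cn_on_cvg => //; exact: leq_trans (ltnW ik) (leq_ord k).
have [_ Bc Bd] := (continuous_within_itvP _ cd).1 cB.
have dB (x : R) : x \in `]c, d[ -> is_derive x (1 : R)
    (fun y => - B y) (g x * (adjoint D q).[x]).
  move=> xcd; rewrite -[_ * _]opprK; apply: is_deriveN.
  apply: is_derive_boundary_form => //; first by rewrite interior_itv_bnd.
  by apply: Dg; apply: subset_itv_oo_cc xcd.
rewrite /Rintegral (@continuous_FTC2 _ _ (fun y => - B y)) //=.
- by rewrite opprK addrC.
- exact: Cn_on_mul_horner_within.
- split.
  + by move=> x /dB[].
  + exact: cvgN.
  + exact: cvgN.
- by move=> x /dB dBx; rewrite derive1E; apply: derive_val.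
Qed.

End Piece.

(** * Gluing intervals, and integrals against polynomials as combinations of moments *)

Lemma integrable_chain (R : realType) (t : nat -> R) (h : R -> R) m :
  (forall i, (i < m)%N -> t i < t i.+1) ->
  (forall i, (i < m)%N ->
    lebesgue_measure.-integrable `[t i, t i.+1] (EFin \o h)) ->
  [/\ t 0%N <= t m,
      lebesgue_measure.-integrable `[t 0%N, t m] (EFin \o h) &
      \int[lebesgue_measure]_(x in `[t 0%N, t m]) h x =
      \sum_(i < m) \int[lebesgue_measure]_(x in `[t i, t i.+1]) h x].
Proof.
elim: m => [|m IH] tS ih.
  rewrite set_itv1 Rintegral_set1 big_ord0; split=> //.
  apply/integrableP; split; first exact: measurable_fun_set1.
  by rewrite integral_set1.
have [t0m i0m E] := IH (fun i im => tS i (ltnW im)) (fun i im => ih i (ltnW im)).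
have tm := tS m (ltnSn m); have im := ih m (ltnSn m).
split; first exact: le_trans t0m (ltW tm).
  exact: integrable_cat i0m im.
by rewrite (Rintegral_cat tm t0m i0m im) E big_ord_recr.
Qed.

Lemma Rintegral_horner_moments (R : realType) (a b : R) (f : R -> R)
    (r : {poly R}) :
  (forall s : {poly R}, lebesgue_measure.-integrable `[a, b]
    (EFin \o (fun x => f x * s.[x]))) ->
  \int[lebesgue_measure]_(x in `[a, b]) (f x * r.[x]) =
  \sum_(i < size r) r`_i * moment a b f i.
Proof.
(* Expanding [r] only under the integral lets the induction run over its truncations, with the
   coefficients fixed. *)
move=> fi; rewrite -{1}[r]coefK; move: (size r) => N.
elim: N => [|N IH].
  rewrite big_ord0; transitivity (\int[lebesgue_measure]_(x in `[a, b]) (0 : R)).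
    by apply: eq_Rintegral => x _; rewrite poly_def big_ord0 horner0 mulr0.
  by rewrite Rintegral_cst ?mul0r.
rewrite big_ord_recr /= -IH /moment.
have iN : lebesgue_measure.-integrable `[a, b] (EFin \o (fun x => x ^+ N * f x)).
  have := fi 'X^N; congr (_.-integrable _ (EFin \o _)); apply/funext => x.
  by rewrite hornerXn mulrC.
rewrite -RintegralZl // -RintegralD //.
  apply: eq_Rintegral => x _.
  rewrite poly_def big_ord_recr /= -poly_def hornerD hornerZ hornerXn; ring.
have := fi (r`_N *: 'X^N); congr (_.-integrable _ (EFin \o _)).
by apply/funext => x; rewrite hornerZ hornerXn; ring.
Qed.

Lemma near_eq_lim (R : realType) (F : set_system R) (f g : R -> R) :
  Filter F -> {near F, f =1 g} -> lim (f y @[y --> F]) = lim (g y @[y --> F]).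
Proof.
move=> FF fg; congr (lim _); apply/seteqP; split; first exact: near_eq_cvg.
by apply: near_eq_cvg; apply: filterS fg => y.
Qed.

(** * The test polynomial *)

Section TestPolynomial.
Variables (R : realType) (p m : nat) (xi : 'I_p.+2 -> R) (j : 'I_p.+2).

(** Here [m.+1] stands for the order [n]; the subtracted boolean lowers the exponent to [n - 1] at
    [xi j] alone. *)
Definition test_poly : {poly R} :=
  \prod_(i < p.+2) ('X - (xi i)%:P) ^+ (m.+1 - (i == j)).

(** The degree is [(p + 1) n + (n - 1)]; the unit lost at [j] is regained by passing from degree to
    size. *)
Lemma size_test_poly : size test_poly = ((p + 2) * m.+1)%N.
Proof.
rewrite /test_poly size_prod => [|i _]; last first.
  by rewrite expf_neq0 // polyXsubC_eq0.
rewrite (eq_bigr (fun i => (m.+1 - (i == j)).+1)) => [|i _]; last first.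
  by rewrite size_exp_XsubC.
rewrite (bigD1 j) //= eqxx (eq_bigr (fun=> m.+2)) => [|i /negbTE ->]; last first.
  by rewrite subn0.
rewrite sum_nat_const.
have -> : #|[pred i : 'I_p.+2 | i != j]| = p.+1.
  by transitivity #|predC1 j|; [exact: eq_card | rewrite cardC1 card_ord].
have -> : #|[pred i : 'I_p.+2 | true]| = p.+2 by rewrite -[RHS]card_ord.
lia.
Qed.

Lemma test_polyE i : i != j ->
  exists s, test_poly = s * ('X - (xi i)%:P) ^+ m.+1.
Proof.
move=> /negbTE ij; rewrite /test_poly (bigD1 i) //= ij subn0 mulrC.
by eexists.
Qed.

Lemma test_polyjE : injective xi ->
  exists2 s, s.[xi j] != 0 & test_poly = s * ('X - (xi j)%:P) ^+ m.
Proof.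
move=> xiI; rewrite /test_poly (bigD1 j) //= eqxx subn1 mulrC.
eexists; last by [].
rewrite horner_prod; apply/prodf_neq0 => i /negbTE ij.
rewrite horner_exp hornerXsubC expf_neq0 // subr_eq0 (inj_eq xiI) eq_sym.
by rewrite ij.
Qed.

End TestPolynomial.

(** * Boundary terms and jumps of a piecewise solution *)

Section PiecewiseSolution.
Variables (R : realType) (a b : R) (n p : nat) (D : 'I_n.+1 -> {poly R}).
Variables (xi : 'I_p.+2 -> R) (f : R -> R).
Hypothesis hf : PD D a b xi f.

(** [wid i] and [nxt i] index the endpoints of the [i]-th continuity interval, in the form produced
    by [big_ord_recr] and [big_ord_recl]. *)
Let wid (i : 'I_p.+1) : 'I_p.+2 := widen_ord (leqnSn p.+1) i.
Let nxt (i : 'I_p.+1) : 'I_p.+2 := lift ord0 i.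
Let branch i := closed_branch f (xi (wid i)) (xi (nxt i)).
Let bform i := boundary_form D `[xi (wid i), xi (nxt i)] (branch i).
Let rlim x := lim ((f \_ `[a, b]) y @[y --> x^'+]).
Let llim x := lim ((f \_ `[a, b]) y @[y --> x^'-]).

Lemma PD_inj : injective xi.
Proof.
move=> i j; have [//|ij] := eqVneq i j; have := PD_increasing hf.
have : (i < j)%N || (j < i)%N by rewrite -neq_ltn.
by case/orP => lt /(_ _ _ lt) + E; rewrite E ltxx.
Qed.

Let xi_lt i : xi (wid i) < xi (nxt i).
Proof. exact: (PD_increasing hf). Qed.

Let xi_le i : a <= xi i <= b.
Proof.
rewrite -(PD_first hf) -(PD_last hf); apply/andP; split.
  have [->//|i0] := eqVneq i ord0; apply/ltW/(PD_increasing hf).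
  by rewrite lt0n.
have [->//|im] := eqVneq i ord_max; apply/ltW/(PD_increasing hf).
by rewrite ltn_neqAle im /= -ltnS.
Qed.

Let branchE i : {in `]xi (wid i), xi (nxt i)[, f =1 branch i}.
Proof.
move=> x; rewrite in_itv /= => /andP[cx xd].
by rewrite /branch /closed_branch (gt_eqF cx) (lt_eqF xd).
Qed.

Let restrictE i x : xi (wid i) < x < xi (nxt i) -> (f \_ `[a, b]) x = f x.
Proof.
move=> /andP[cx xd]; rewrite patchE mem_set //= in_itv /=.
have /andP[ac _] := xi_le (wid i); have /andP[_ db] := xi_le (nxt i).
by rewrite (le_trans ac (ltW cx)) (le_trans (ltW xd) db).
Qed.

Let branch_left i : branch i (xi (wid i)) = rlim (xi (wid i)).
Proof.
rewrite /branch /closed_branch eqxx; apply: near_eq_lim; near=> y.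
rewrite (@restrictE i) //; apply/andP; split; near: y.
  exact: nbhs_right_gt.
exact: nbhs_right_lt (xi_lt i).
Unshelve. all: by end_near. Qed.

Let branch_right i : branch i (xi (nxt i)) = llim (xi (nxt i)).
Proof.
rewrite /branch /closed_branch (gt_eqF (xi_lt i)) eqxx.
apply: near_eq_lim; near=> y.
rewrite (@restrictE i) //; apply/andP; split; near: y.
  exact: nbhs_left_gt (xi_lt i).
exact: nbhs_left_lt.
Unshelve. all: by end_near. Qed.

Let llim_first : llim a = 0.
Proof.
rewrite /llim (near_eq_lim (g := fun=> 0)) ?lim_cst //; near=> y.
rewrite patchE memNset //= in_itv /=; apply/negP; rewrite negb_and.
apply/orP; left; rewrite -ltNge; near: y; exact: nbhs_left_lt.
Unshelve. all: by end_near. Qed.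

Let rlim_last : rlim b = 0.
Proof.
rewrite /rlim (near_eq_lim (g := fun=> 0)) ?lim_cst //; near=> y.
rewrite patchE memNset //= in_itv /=; apply/negP; rewrite negb_and.
apply/orP; right; rewrite -ltNge; near: y; exact: nbhs_right_gt.
Unshelve. all: by end_near. Qed.

Let integrable_branch i (r : {poly R}) : lebesgue_measure.-integrable
  `[xi (wid i), xi (nxt i)] (EFin \o (fun x => branch i x * r.[x])).
Proof. by apply: integrable_Cn_on_mul_horner; exact: (PD_smooth hf). Qed.

Let integrable_piece i (r : {poly R}) : lebesgue_measure.-integrable
  `[xi (wid i), xi (nxt i)] (EFin \o (fun x => f x * r.[x])).
Proof.
apply: eq_integrable_itvoo (integrable_branch i r) => x xi_x.
by rewrite (branchE xi_x).
Qed.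

Lemma PD_integral (r : {poly R}) :
  lebesgue_measure.-integrable `[a, b] (EFin \o (fun x => f x * r.[x])) /\
  \int[lebesgue_measure]_(x in `[a, b]) (f x * r.[x]) =
  \sum_(i < p.+1) \int[lebesgue_measure]_(x in `[xi (wid i), xi (nxt i)])
    (f x * r.[x]).
Proof.
(* The points are reindexed by [nat] to fit [integrable_chain]; only indices up to [p.+1] matter. *)
pose t k := xi (inord k).
have tw i : t (nat_of_ord i) = xi (wid i).
  by congr xi; apply/val_inj; rewrite /= inordK // ltnW // ltnS.
have tn i : t (i : 'I_p.+1).+1 = xi (nxt i).
  by congr xi; apply/val_inj; rewrite /= inordK // ltnS.
have t0 : t 0%N = a.
  by rewrite -(PD_first hf); congr xi; apply/val_inj; rewrite /= inordK.
have tm : t p.+1 = b.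
  by rewrite -(PD_last hf); congr xi; apply/val_inj; rewrite /= inordK.
have [||_ i E] := @integrable_chain R t (fun x => f x * r.[x]) p.+1.
- by move=> i ip; rewrite (tw (Ordinal ip)) (tn (Ordinal ip)).
- by move=> i ip; rewrite (tw (Ordinal ip)) (tn (Ordinal ip)).
rewrite t0 tm in i E; split=> //; rewrite E.
by apply: eq_bigr => k _; rewrite tw tn.
Qed.

Lemma PD_integral_adjoint (q : {poly R}) :
  \int[lebesgue_measure]_(x in `[a, b]) (f x * (adjoint D q).[x]) =
  \sum_(i < p.+1) (bform i q (xi (wid i)) - bform i q (xi (nxt i))).
Proof.
have [_ ->] := PD_integral (adjoint D q); apply: eq_bigr => i _.
rewrite -(integral_adjoint (xi_lt i)); last 2 first.
- exact: (PD_smooth hf).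
- exact: (PD_equation hf).
apply: (eq_Rintegral_itvoo _ (integrable_branch i _)) => x xi_x.
by rewrite (branchE xi_x).
Qed.

Lemma PD_integral_test_poly j m : n = m.+1 -> (D ord_max).[xi j] != 0 ->
  exists2 C, C != 0 &
    \int[lebesgue_measure]_(x in `[a, b])
      (f x * (adjoint D (test_poly m xi j)).[x]) =
    C * (rlim (xi j) - llim (xi j)).
Proof.
move=> nm Dj; have [s sj qj] := test_polyjE m j PD_inj.
exists ((-1) ^+ m * ((D ord_max * s).[xi j] *+ m`!)).
  rewrite mulf_neq0 ?expf_neq0 ?oppr_eq0 ?oner_eq0 //.
  by rewrite mulrn_eq0 negb_or -lt0n fact_gt0 hornerM mulf_neq0.
set C := (X in X * _).
(* Only [xi j] contributes, and with the same constant [C] from the interval on either side, so the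
   two one-sided values combine into a jump. *)
have bE i k : bform i (test_poly m xi j) (xi k) =
    if k == j then C * branch i (xi k) else 0.
  have [->|kj] := eqVneq k j.
    by rewrite qj /bform (boundary_formE _ _ _ _ _ nm) /C; ring.
  by have [r ->] := test_polyE m xi kj; rewrite -nm; apply: boundary_form_eq0.
rewrite PD_integral_adjoint sumrB mulrBr; congr (_ - _).
  rewrite (eq_bigr (fun i => if wid i == j then C * rlim (xi (wid i)) else 0));
    last by move=> i _; rewrite bE branch_left.
  (* Left endpoints omit [xi ord_max]; adding it is harmless because the zero extension has right
     limit 0 at [b]. *)
  transitivity (\sum_(i < p.+2) if i == j then C * rlim (xi i) else 0).
    by rewrite [RHS]big_ord_recr /= (PD_last hf) rlim_last mulr0 if_same addr0.
  by rewrite -big_mkcond big_pred1_eq.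
rewrite (eq_bigr (fun i => if nxt i == j then C * llim (xi (nxt i)) else 0));
  last by move=> i _; rewrite bE branch_right.
(* Symmetrically, right endpoints omit [xi ord0], where the left limit is 0. *)
transitivity (\sum_(i < p.+2) if i == j then C * llim (xi i) else 0).
  by rewrite [RHS]big_ord_recl /= (PD_first hf) llim_first mulr0 if_same add0r.
by rewrite -big_mkcond big_pred1_eq.
Qed.

End PiecewiseSolution.

(** * Vanishing moments against a nonzero jump *)

Theorem theorem2 (R : realType) (a b : R) (n p : nat)
    (D : 'I_n.+1 -> {poly R}) (xi : 'I_p.+2 -> R) (f : R -> R)
    (hab : a < b) (hn : (1 <= n)%N) (hD : D ord_max != 0)
    (hf : PD D a b xi f) (hf0 : ~ vanishes_off a b xi f)
    (hxi : exists j : 'I_p.+2, (D ord_max).[xi j] != 0) :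
  ~ (forall k : nat,
       ((k%:Z)%:E <= (((p + 2) * n)%N%:Z)%:E + alpha D - (1%:Z)%:E)%E ->
       moment a b f k = 0).
Proof.
move=> mom0; have [j Dj] := hxi.
have nm : n = n.-1.+1 by rewrite prednK.
have [C C0 CE] := PD_integral_test_poly hf nm Dj.
have [_ _ jump] := PD_jump hf j.
have : C * (lim ((f \_ `[a, b]) y @[y --> (xi j)^'+]) -
    lim ((f \_ `[a, b]) y @[y --> (xi j)^'-])) != 0.
  by rewrite mulf_neq0 // subr_eq0.
rewrite -CE => /eqP; apply.
rewrite Rintegral_horner_moments => [|r]; last by have [] := PD_integral hf r.
rewrite big1 // => k _.
(* Each product vanishes: within the bound the moment is zero, beyond it the coefficient of the
   adjoint is. *)
have [kle|kN] := pselect ((((k : nat)%:Z)%:E <=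
    (((p + 2) * n)%N%:Z)%:E + alpha D - (1%:Z)%:E)%E).
  by rewrite mom0 ?mulr0.
by rewrite adjoint_coef_eq0 ?mul0r // size_test_poly -nm.
Qed.
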